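(* Let $r\in\mathbb{N}$. Every $r$-regular digraph $D$ satisfies $c(D)\ge \left\lceil\frac{3}{22} r\right\rceil$.
   Context: Digraphs are finite, have no loops and no parallel arcs (two oppositely oriented arcs between the same pair of vertices are allowed). A digraph is $r$-regular if every vertex has out-degree and in-degree exactly $r$. A collection of openly disjoint directed cycles through a vertex is a collection of directed cycles $C_1,\ldots,C_k$ in $D$ such that some vertex $v$ lies on all of them and the sets $V(C_1)\setminus\{v\},\ldots,V(C_k)\setminus\{v\}$ are pairwise disjoint. $c(D)$ denotes the maximum size of such a collection in $D$. *)

(* Defs.v *)
From HB Require Import structures.
From mathcomp Require Export all_boot all_order all_algebra.

Set Implicit Arguments.
Unset Strict Implicit.
Unset Printing Implicit Defensive.

(* A digraph on the vertex set T is an irreflexive relation e : rel T, where  *)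
(* e x y means that (x, y) is an arc; e need not be symmetric or              *)
(* antisymmetric.                                                             *)

Definition out_degree (T : finType) (e : rel T) (v : T) : nat :=
  #|[set w | e v w]|.

Definition in_degree (T : finType) (e : rel T) (v : T) : nat :=
  #|[set w | e w v]|.

Definition regular_digraph (r : nat) (T : finType) (e : rel T) : Prop :=
  forall v : T, out_degree e v = r /\ in_degree e v = r.

(* The vertices of a cycle are pairwise distinct, so all directed cycles are  *)
(* among the sequences of length at most #|T|, which form a finite type.      *)
(* A digon [:: x; y] with e x y and e y x is a directed cycle.                *)
Definition dicycle (T : finType) (e : rel T) (C : #|T|.-bseq T) : bool :=
  (0 < size C) && ucycleb e C.

(* Rotations of one cycle are distinct sequences, but they are never both in  *)
(* an openly disjoint collection: when e is irreflexive a cycle through v has *)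
(* a vertex other than v.                                                     *)
Definition openly_disjoint (T : finType) (e : rel T)
    (A : {set #|T|.-bseq T}) : bool :=
  [exists v : T,
     [forall C in A, dicycle e C && (v \in C)] &&
     [forall C1 in A, forall C2 in A, (C1 != C2) ==>
        [disjoint [set x in C1] :\ v & [set x in C2] :\ v]]].

Definition max_openly_disjoint (T : finType) (e : rel T) : nat :=
  \max_(A : {set #|T|.-bseq T} | openly_disjoint e A) #|A|.

(* Main.v *)
(* Let m be the largest number of openly disjoint cycles and suppose          *)
(* 22 m < 3 r. By Hall's theorem, applied after blowing v up into m + 1       *)
(* copies, every vertex v has a Menger cut: sets X_v and S_v with             *)
(* #|S_v| <= m such that all arcs leaving v or X_v end in X_v or S_v, and no  *)
(* arc goes from X_v to v. Hence v lies on at most m digons, and, as          *)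
(* in-degrees are r, at most r m arcs leave X_v; by regularity equally many   *)
(* enter it.                                                                  *)
(* Take X of minimal size subject to #|X| >= r / 2 and d(X) <= 2 r m, where d *)
(* counts the leaving (equivalently, entering) arcs. The digon bound forces   *)
(* #|X| >= 3 r / 2, so some w in X has at least 7 r / 11 in- and              *)
(* out-neighbours inside X. Cutting X along X_w leaves two parts with more    *)
(* than r / 2 vertices each, whose boundaries sum to at most                  *)
(* d(X) + 2 r m <= 4 r m, so one of the parts contradicts minimality.         *)

Require Import Defs.
From mathcomp Require Import all_boot all_order all_algebra zify lra.

Set Implicit Arguments.
Unset Strict Implicit.
Unset Printing Implicit Defensive.

(** Cycles through [v] that meet only in [v] come from matchings in a blown-up digraph
    ([blow_up_matching_cycles]); where Hall's condition fails, the violating set yields a small cut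
    ([blow_up_violation_cut]). Splitting a minimal set of small boundary along such a cut is
    contradictory ([regular_digraph_cut_false]). The counts in [small_boundary_card] and
    [exists_balanced_vertex] both become tight at m = 3r/22. *)

(** * Hall's marriage theorem *)

Section Hall.
Variables L R : finType.
Implicit Types (A : {ffun L -> {set R}}) (W : {set L}).

Definition hall_condition A : bool :=
  [forall W : {set L}, #|W| <= #|\bigcup_(x in W) A x|].

Definition hall_remove A x y : {ffun L -> {set R}} :=
  [ffun z => if z == x then A x :\ y else A z].

Lemma hall_remove_sub A x y z : hall_remove A x y z \subset A z.
Proof. by rewrite ffunE; case: eqP => // ->; apply: subD1set. Qed.

Lemma hall_remove_violation A x y :
    hall_condition A -> ~~ hall_condition (hall_remove A x y) ->
  exists2 W : {set L}, x \in W &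
    #|\bigcup_(z in W) hall_remove A x y z| < #|W|.
Proof.
move=> /forallP hA /forallPn[W]; rewrite -ltnNge => hW; exists W => //.
apply/negPn/negP => xW.
suff E : \bigcup_(z in W) hall_remove A x y z = \bigcup_(z in W) A z.
  by move: (hA W); rewrite -E leqNgt hW.
apply: eq_bigr => z zW; rewrite ffunE; case: eqP => // zx.
by rewrite -zx zW in xW.
Qed.

(* Two violating sets both contain x, and the submodularity of the            *)
(* neighbourhood size turns them into a violation of the original condition   *)
(* on their union or on their intersection minus x.                           *)
Lemma hall_remove_either A x y1 y2 :
    hall_condition A -> y1 != y2 ->
  hall_condition (hall_remove A x y1) || hall_condition (hall_remove A x y2).
Proof.
move=> hA y12; apply/orP.
case: (boolP (hall_condition (hall_remove A x y1))) => h1; first by left.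
case: (boolP (hall_condition (hall_remove A x y2))) => h2; first by right.
have [W1 x1 lt1] := hall_remove_violation hA h1.
have [W2 x2 lt2] := hall_remove_violation hA h2.
set N1 := \bigcup_(z in W1) _ in lt1; set N2 := \bigcup_(z in W2) _ in lt2.
have sU : \bigcup_(z in W1 :|: W2) A z \subset N1 :|: N2.
  apply/bigcupsP => z zW; have [->|zx] := eqVneq z x.
    apply/subsetP => y yA; rewrite inE; apply/orP.
    have [yy1|yy1] := eqVneq y y1.
      right; apply/bigcupP; exists x => //.
      by rewrite ffunE eqxx !inE yA yy1 y12.
    by left; apply/bigcupP; exists x => //; rewrite ffunE eqxx !inE yA yy1.
  move: zW; rewrite inE => /orP[] zW; apply/subsetP => y yA; rewrite inE;
    apply/orP; [left|right]; apply/bigcupP; exists z => //;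
    by rewrite ffunE (negPf zx).
have sI : \bigcup_(z in (W1 :&: W2) :\ x) A z \subset N1 :&: N2.
  apply/bigcupsP => z; rewrite !inE => /and3P[zx z1 z2].
  apply/subsetP => y yA; rewrite inE.
  by apply/andP; split; apply/bigcupP; exists z => //; rewrite ffunE (negPf zx).
have := leq_trans (forallP hA _) (subset_leq_card sU).
have := leq_trans (forallP hA _) (subset_leq_card sI).
have := cardsUI N1 N2; have := cardsUI W1 W2.
have := cardsD1 x (W1 :&: W2); rewrite inE x1 x2 /=.
lia.
Qed.

(** Rado's argument: delete elements one at a time while Hall's condition survives; once all sets
    are singletons, the condition on pairs gives injectivity. *)
Theorem hall_matching A : hall_condition A ->
  exists2 f : L -> R, injective f & forall x, f x \in A x.
Proof.
have [n] := ubnP (\sum_x #|A x|); elim: n A => // n IH A lt_n hA.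
have card_gt0 x : 0 < #|A x|.
  by have := forallP hA [set x]; rewrite cards1 big_set1.
have step x y : y \in A x -> hall_condition (hall_remove A x y) ->
    exists2 f : L -> R, injective f & forall x, f x \in A x.
  move=> yA /IH[|f f_inj fA].
    rewrite -ltnS; apply: leq_trans lt_n; rewrite ltnS.
    rewrite (bigD1 x) //= [X in _ < X](bigD1 x) //= -addSn.
    apply: leq_add; last first.
      by apply: leq_sum => z _; apply/subset_leq_card/hall_remove_sub.
    by rewrite ffunE eqxx [X in _ < X](cardsD1 y) yA.
  by exists f => // z; apply: (subsetP (hall_remove_sub A x y z)).
have [/existsP[x /card_gt1P[y1 [y2 [y1A y2A y12]]]]|/existsPn le1] :=
    boolP [exists x, 1 < #|A x|].
  by case/orP: (hall_remove_either x hA y12); apply: step.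
have /fin_all_exists[f fA] x : exists y, A x = [set y].
  by apply/cards1P; rewrite eqn_leq card_gt0 andbT leqNgt; apply: le1.
exists f => [x y fxy|x]; last by rewrite fA inE.
apply/eqP; apply: contraT => xy.
have := forallP hA [set x; y].
by rewrite cards2 xy bigcup_setU !big_set1 !fA fxy setUid cards1.
Qed.

End Hall.

(** * Disjoint cycles through a vertex and Menger cuts *)

Section OpenlyDisjoint.
Variables (T : finType) (e : rel T).
Hypothesis e_loopless : irreflexive e.

Lemma dicycles_max_openly_disjoint (v : T) k (C : 'I_k -> seq T) :
    (forall i, uniq (C i)) -> (forall i, cycle e (C i)) ->
    (forall i, v \in C i) ->
    (forall i j u, u \in C i -> u \in C j -> u != v -> i = j) ->
  k <= max_openly_disjoint e.
Proof.
move=> Cuniq Ccycle Cv Cdisj.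
have Csize i : size (C i) <= #|T| by rewrite -(card_uniqP (Cuniq i)) max_card.
have Cpos i : 0 < size (C i) by case: (C i) (Cv i).
pose D i : #|T|.-bseq T := Bseq (Csize i).
(* A shared vertex other than [v] forces equal indices; a cycle without one would be [[:: v]], a
   loop. *)
have Dinj : injective D.
  move=> i j /(congr1 val) /= Cij.
  have [/allP alone|/allPn[u uC uv]] := boolP (all (pred1 v) (C i)).
    have Ci : C i = [:: v].
      case: (C i) (Cuniq i) alone (Cv i) => [//|a [|b s]] /= uab alone _.
        by rewrite (eqP (alone a _)) ?inE.
      move: uab; rewrite (eqP (alone a _)) ?inE ?eqxx //.
      by rewrite (eqP (alone b _)) ?inE ?eqxx ?orbT.
    by have := Ccycle i; rewrite Ci /= e_loopless.
  by apply: (Cdisj _ _ u); rewrite -?Cij.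
have {1}-> : k = #|D @: [set: 'I_k]| by rewrite card_imset // cardsT card_ord.
apply: (leq_bigmax_cond (F := fun A : {set #|T|.-bseq T} => #|A|)).
apply/existsP; exists v; apply/andP; split.
  apply/forall_inP => _ /imsetP[i _ ->]; rewrite /dicycle /ucycleb Cuniq Ccycle.
  by rewrite (Cv i : v \in D i) !andbT /=; apply: Cpos.
apply/forall_inP => _ /imsetP[i _ ->]; apply/forall_inP => _ /imsetP[j _ ->].
apply/implyP => Dij; rewrite -setI_eq0; apply/eqP/setP => u; rewrite !inE.
apply/negP => /andP[/andP[uv uCi] /andP[_ uCj]].
by rewrite (Cdisj i j u uCi uCj uv) eqxx in Dij.
Qed.


Section BlowUp.
Variables (v : T) (k : nat).
Local Notation L := (T + 'I_k)%type.

(* The vertex v is replaced by k copies inr i, and every other vertex gets a  *)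
(* loop; the now redundant element inl v can only be matched to itself.       *)
Definition blow_up : {ffun L -> {set L}} :=
  [ffun x : L => match x with
   | inl u => if u == v then [set inl v] else
       [set y : L | match y with
                    | inl w => (w != v) && ((w == u) || e u w)
                    | inr _ => e u v
                    end]
   | inr _ => [set y : L | if y is inl w then e v w else false]
   end].

Definition blow_down (x : L) : T := if x is inl u then u else v.

(** [f] permutes a finite type, so the orbit of each copy of [v] meets a copy again, perhaps another
    one. The stretch before this first return blows down to a cycle through [v], and injectivity
    keeps different stretches apart. *)
Lemma blow_up_matching_cycles (f : L -> L) :
    injective f -> (forall x, f x \in blow_up x) ->
  k <= max_openly_disjoint e.
Proof.
move=> f_inj fA.
have ret_ex i : exists n, is_inl (iter n.+1 f (inr i)) == false.
  by exists (order f (inr i)).-1; rewrite prednK ?order_gt0 // iter_order.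
pose len i := (ex_minn (ret_ex i)).+1.
have len_ret i : is_inl (iter (len i) f (inr i)) = false.
  by rewrite /len; case: ex_minnP => n /eqP.
have len_min i n : 0 < n < len i -> is_inl (iter n f (inr i)).
  case: n => // n; rewrite /len; case: ex_minnP => m _ min /= lt_nm.
  by apply: contraTT lt_nm => ret; rewrite -leqNgt ltnS min // eqbF_neg.
have f_inr i : is_inl (f (inr i)).
  by have := fA (inr i); rewrite ffunE inE; case: (f _).
have f_v : f (inl v) = inl v.
  by have := fA (inl v); rewrite ffunE eqxx inE => /eqP.
have iter_inj n : injective (iter n f).
  by elim: n => // n IH x y /= /f_inj /IH.
pose g i n := blow_down (iter n f (inr i)).
have gE i n : 0 < n < len i -> iter n f (inr i) = inl (g i n).
  by move=> /len_min; rewrite /g; case: (iter _ _ _).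
have g0 i n : n < len i -> (g i n == v) = (n == 0).
  case: n => [|n] lt_n; first by rewrite !eqxx.
  apply/negP => /eqP gv; suff : inr i = inl v :> L by [].
  have iter_v m : iter m f (inl v) = inl v by elim: m => //= m ->.
  by apply: (iter_inj n.+1); rewrite iter_v gE ?gv.
(* Cancelling [n] steps puts the copy [inr i] at time [m - n] on the orbit of [inr j]; before the
   first return this time must be 0. *)
have meet i j n m : n <= m -> m < len j ->
    iter n f (inr i) = iter m f (inr j) -> i = j /\ n = m.
  move=> /subnKC <-; set d := m - n; rewrite iterD => lt_m.
  move=> /iter_inj; case: d lt_m => [|d] lt_m ij.
    by case: ij => ->; rewrite addn0.
  have : is_inl (iter d.+1 f (inr j)) by apply: len_min; lia.
  by rewrite -ij.
have g_inj i j n m : n < len i -> m < len j -> g i n = g j m -> g i n != v ->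
    i = j /\ n = m.
  move=> lt_n lt_m gnm.
  have := congr1 (eq_op^~ v) gnm; rewrite !g0 // => n0m.
  rewrite -lt0n => n_gt0; have m_gt0 : 0 < m by lia.
  have {gnm} : iter n f (inr i) = iter m f (inr j).
    by rewrite !gE ?gnm ?n_gt0 ?m_gt0.
  case: (leqP n m) => [le_nm|/ltnW le_mn] E; first exact: meet E.
  by have [-> ->] := meet _ _ _ _ le_mn lt_n (esym E).
have step i n : n < len i -> e (g i n) (g i n.+1).
  case: n => [|n] lt_n.
    by have := fA (inr i); rewrite ffunE inE /g /=; case: (f _).
  have := fA (iter n.+1 f (inr i)); rewrite /g !iterS -iterS.
  have := g0 i _ lt_n; rewrite gE // ffunE /= => ->; rewrite inE.
  case E: (f _) => [w|] //= /andP[_ /orP[/eqP wg|//]].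
  (* Using the loop here would, after cancelling iterates, make [f] fix [inr i]. *)
  have: iter n.+1 f (f (inr i)) = iter n.+1 f (inr i).
    by rewrite -iterSr iterS gE // E wg.
  by move/iter_inj => fi; have := f_inr i; rewrite fi.
pose C i := mkseq (g i) (len i).
have CP i u : reflect (exists2 n, n < len i & u = g i n) (u \in C i).
  apply: (iffP mapP) => [[n n_len ->]|[n n_len ->]]; exists n => //.
    by move: n_len; rewrite mem_iota.
  by rewrite mem_iota.
apply: (dicycles_max_openly_disjoint (v := v) (C := C)) => [i|i|i|i j u].
- apply/mkseq_uniqP => n m; rewrite !inE => lt_n lt_m gnm.
  have [gv|gv] := boolP (g i n == v); last by case: (g_inj i i n m).
  by have := gv; rewrite gnm; move: gv; rewrite !g0 // => /eqP-> /eqP->.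
- rewrite /C /mkseq /len /=; set l := ex_minn _.
  have -> : g i 0 = g i l.+1.
    by have := len_ret i; rewrite /len -/l /g; case: (iter l.+1 _ _).
  have {1}-> : g i l.+1 = g i 0.
    by have := len_ret i; rewrite /len -/l /g; case: (iter l.+1 _ _).
  rewrite -map_rcons -cats1 -(iotaD 1 l 1) addn1.
  apply/(pathP v) => n; rewrite size_map size_iota => lt_n.
  rewrite (nth_map 0) ?size_iota // nth_iota // add1n.
  have -> : nth v (g i 0 :: [seq g i n | n <- iota 1 l.+1]) n = g i n.
    case: n lt_n => // n lt_n.
    rewrite -[LHS]/(nth v [seq g i m | m <- iota 1 l.+1] n).
    by rewrite (nth_map 0) ?size_iota ?nth_iota //; lia.
  exact: step.
- by apply/CP; exists 0.
- move=> /CP[n lt_n ->] /CP[m lt_m gnm] gv.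
  by case: (g_inj i j n m).
Qed.

(** [W] must contain a copy of [v], and no arc may go from [X] to [v]: otherwise the loops, with all
    copies in the second case, would put [W] inside [N]. So [N] contains the disjoint sets [W0] and
    [S], while [W] has at most #|W0| + k elements. *)
Lemma blow_up_violation_cut : ~~ hall_condition blow_up ->
  exists X S : {set T},
    [/\ #|S| < k, forall u, e v u -> u \in X :|: S,
        forall u, u \in X -> ~~ e u v &
        forall u w, u \in X -> e u w -> w \in X :|: S].
Proof.
move=> /forallPn[W]; rewrite -ltnNge; set N := \bigcup_(x in W) _ => lt_NW.
pose W0 := [set u | inl u \in W]; pose X := W0 :\ v.
have XW u : u \in X -> (u != v) * (inl u \in W).
  by rewrite !inE => /andP[-> ->].
pose S := [set w | (w \notin v |: X) &&
                   (e v w || [exists u, (u \in X) && e u w])].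
pose copies : {set L} := inr @: [set: 'I_k].
have inlI : injective (inl : T -> L) by move=> x y [].
have card_W0k : #|inl @: W0 :|: copies| = #|W0| + k.
  rewrite cardsU (card_imset _ inlI) card_imset; last by move=> x y [].
  rewrite cardsT card_ord (_ : _ :&: _ = set0) ?cards0 ?subn0 //.
  apply/setP => x; rewrite !inE; apply/negP => /andP[/imsetP[u _ ->]].
  by move=> /imsetP[j _].
have W_sub : W \subset inl @: W0 :|: copies.
  apply/subsetP => -[u|i] xW; rewrite inE; apply/orP.
    by left; apply/imsetP; exists u; rewrite ?inE.
  by right; apply/imsetP; exists i.
have W0_N : inl @: W0 \subset N.
  apply/subsetP => _ /imsetP[u + ->]; rewrite inE => uW.
  apply/bigcupP; exists (inl u) => //.
  by rewrite ffunE; case: eqP => [->|/eqP uv]; rewrite !inE ?uv eqxx.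
have /existsP[i iW] : [exists i, inr i \in W].
  apply: contraT => /existsPn noW.
  suff /subset_leq_card : W \subset N by rewrite leqNgt lt_NW.
  apply: subset_trans W0_N; apply/subsetP => -[u|i] xW.
    by apply/imsetP; exists u; rewrite ?inE.
  by have := noW i; rewrite xW.
have Xv u : u \in X -> ~~ e u v.
  move=> uX; apply/negP => uv.
  suff /subset_leq_card : W \subset N by rewrite leqNgt lt_NW.
  apply: subset_trans W_sub _; rewrite subUset W0_N.
  apply/subsetP => _ /imsetP[j _ ->]; apply/bigcupP; exists (inl u).
    by rewrite XW.
  by rewrite ffunE (negPf (XW u uX).1) inE.
exists X, S; split => //.
- have : (inl : T -> L) @: (W0 :|: S) \subset N.
    apply/subsetP => _ /imsetP[w + ->]; rewrite inE => /orP[wW|].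
      by apply: (subsetP W0_N); apply: imset_f.
    rewrite inE => /andP[]; rewrite !inE negb_or => /andP[wv _].
    case/orP => [vw|/existsP[u /andP[uX uw]]].
      by apply/bigcupP; exists (inr i); rewrite // ffunE inE.
    apply/bigcupP; exists (inl u); first by rewrite XW.
    by rewrite ffunE (negPf (XW u uX).1) inE wv uw orbT.
  move/subset_leq_card; rewrite (card_imset _ inlI) cardsU.
  have -> : W0 :&: S = set0.
    apply/setP => u; rewrite !inE.
    by case: eqP => //= _; case: (inl u \in W).
  rewrite cards0 subn0 => /leq_ltn_trans/(_ lt_NW) lt_W.
  rewrite -(ltn_add2l #|W0|) -card_W0k.
  exact: leq_trans lt_W (subset_leq_card W_sub).
- move=> u vu; rewrite !inE vu /=; have [uv|] := eqVneq u v.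
    by rewrite uv e_loopless in vu.
  by case: (inl u \in W).
- move=> u w uX uw; rewrite in_setU; case: (boolP (w \in X)) => //= wX.
  rewrite [w \in S]inE in_setU1 negb_or wX andbT.
  have -> : w != v by apply: contraTneq uw => ->; apply: Xv.
  by apply/orP; right; apply/existsP; exists u; rewrite uX.
Qed.

End BlowUp.

(* Menger's theorem for the cycles through v: (X, S) is a cut that separates  *)
(* the out-neighbours of v from its in-neighbours.                            *)
Lemma openly_disjoint_cut v : exists X S : {set T},
    [/\ #|S| <= max_openly_disjoint e, forall u, e v u -> u \in X :|: S,
        forall u, u \in X -> ~~ e u v &
        forall u w, u \in X -> e u w -> w \in X :|: S].
Proof.
set m := max_openly_disjoint e.
have /(@blow_up_violation_cut v m.+1) : ~~ hall_condition (blow_up v m.+1).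
  apply/negP => /hall_matching[f f_inj fA].
  by have := blow_up_matching_cycles f_inj fA; rewrite ltnn.
by case=> X [S [cS vX Xv XS]]; exists X, S; split.
Qed.

End OpenlyDisjoint.

(** * Counting arcs across cuts *)

Section Cuts.
Variables (T : finType) (e : rel T) (r : nat).
Hypothesis e_regular : regular_digraph r e.
Implicit Types (X Y Z : {set T}).

(** Summing over all ordered pairs lets inequalities between cuts be checked pair by pair. *)
Definition arcs X Y : nat := \sum_x \sum_y ((x \in X) && (y \in Y) && e x y).

Lemma arcs_out X Y : arcs X Y = \sum_(x in X) #|[set y in Y | e x y]|.
Proof.
rewrite /arcs [RHS]big_mkcond; apply: eq_bigr => x _ /=.
case: (x \in X); last by rewrite big1.
rewrite -sum1_card [RHS]big_mkcond; apply: eq_bigr => y _.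
by rewrite inE; case: ifP.
Qed.

Lemma arcs_in X Y : arcs X Y = \sum_(y in Y) #|[set x in X | e x y]|.
Proof.
rewrite /arcs exchange_big [RHS]big_mkcond; apply: eq_bigr => y _ /=.
case: (y \in Y); last by rewrite big1 // => x _; rewrite andbF.
rewrite -sum1_card [RHS]big_mkcond; apply: eq_bigr => x _.
by rewrite inE andbT; case: ifP.
Qed.

Lemma arcs_out_setC X Y : arcs X Y + arcs X (~: Y) = r * #|X|.
Proof.
rewrite !arcs_out -big_split mulnC -sum_nat_const; apply: eq_bigr => x _ /=.
rewrite -(e_regular x).1 /out_degree -[RHS](cardsID Y).
by congr (_ + _); apply: eq_card => y; rewrite !inE andbC.
Qed.

Lemma arcs_in_setC X Y : arcs Y X + arcs (~: Y) X = r * #|X|.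
Proof.
rewrite !arcs_in -big_split mulnC -sum_nat_const; apply: eq_bigr => x _ /=.
rewrite -(e_regular x).2 /in_degree -[RHS](cardsID Y).
by congr (_ + _); apply: eq_card => y; rewrite !inE andbC.
Qed.

Lemma arcs_setC_sym X : arcs (~: X) X = arcs X (~: X).
Proof. by have := arcs_out_setC X X; have := arcs_in_setC X X; lia. Qed.

(** An arc leaving one of the two parts leaves [X] or crosses [Z] in some direction, and its tail
    lies in only one part. *)
Lemma arcs_split X Z :
  arcs (X :&: Z) (~: (X :&: Z)) + arcs (X :\: Z) (~: (X :\: Z)) <=
  arcs X (~: X) + arcs Z (~: Z) + arcs (~: Z) Z.
Proof.
rewrite /arcs -!big_split; apply: leq_sum => x _ /=.
rewrite -!big_split; apply: leq_sum => y _ /=; rewrite !inE.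
by case: (x \in X); case: (y \in X); case: (x \in Z); case: (y \in Z);
  case: (e x y).
Qed.

Lemma arcs_closed_cut X S : (forall u w, u \in X -> e u w -> w \in X :|: S) ->
  arcs X (~: X) <= r * #|S|.
Proof.
move=> XS; rewrite -(arcs_in_setC S X); apply: leq_trans (leq_addr _ _).
rewrite /arcs; apply: leq_sum => x _; apply: leq_sum => y _; rewrite inE.
have [xX|//] := boolP (x \in X).
have [xy|] := boolP (e x y); last by rewrite !andbF.
by have := XS _ _ xX xy; rewrite inE; case: (y \in X) => //= ->.
Qed.

End Cuts.

(** * A minimal set with small boundary *)

Section Main.
Variables (T : finType) (e : rel T) (r m : nat).
Hypothesis e_regular : regular_digraph r e.
Hypothesis m_lt : 22 * m < 3 * r.
Hypothesis cut : forall v, exists X S : {set T},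
    [/\ #|S| <= m, forall u, e v u -> u \in X :|: S,
        forall u, u \in X -> ~~ e u v &
        forall u w, u \in X -> e u w -> w \in X :|: S].
Implicit Types (X Y Z : {set T}).

Local Notation boundary X := (arcs e X (~: X)).

Lemma digons_le v : #|[set u | e v u && e u v]| <= m.
Proof.
have [X [S [cS vXS Xv _]]] := cut v; apply: leq_trans cS.
apply/subset_leq_card/subsetP => u; rewrite inE => /andP[/vXS + uv].
by rewrite inE => /orP[/Xv|//]; rewrite uv.
Qed.

(** At each vertex, the in- and out-neighbours inside [X] have union of size at most #|X| and
    intersection, the digons, at most [m]. *)
Lemma arcs_inside_le X : 2 * arcs e X X <= #|X| * (#|X| + m).
Proof.
rewrite mul2n -addnn {1}arcs_out arcs_in -big_split -sum_nat_const /=.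
apply: leq_sum => v _; rewrite -cardsUI; apply: leq_add.
  by apply/subset_leq_card/subsetP => u; rewrite !inE => /orP[]/andP[].
apply: leq_trans (digons_le v); apply/subset_leq_card/subsetP => u.
by rewrite !inE => /andP[/andP[_ ->] /andP[_ ->]].
Qed.

Lemma small_boundary_card X : boundary X <= 2 * r * m -> r <= 2 * #|X| ->
  3 * r <= 2 * #|X|.
Proof.
move=> dX le_rX; rewrite leqNgt; apply/negP => lt_X.
(* With n = #|X| these give n^2 + nm - 2rn + 4rm >= 0, but this convex quadratic is negative at n =
   r/2 and, exactly when m < 3r/22, at n = 3r/2. *)
have := arcs_inside_le X; have := arcs_out_setC e_regular X X.
nia.
Qed.

Lemma exists_balanced_vertex X : boundary X <= 2 * r * m -> 3 * r <= 2 * #|X| ->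
  exists w, 7 * r <= 11 * #|[set u in X | e w u]| /\
            7 * r <= 11 * #|[set u in X | e u w]|.
Proof.
move=> dX le_X.
have [/existsP[w /andP[]]|/existsPn none] := boolP [exists w,
  (7 * r <= 11 * #|[set u in X | e w u]|) &&
  (7 * r <= 11 * #|[set u in X | e u w]|)].
  by exists w.
(* Without such a vertex, the two degrees inside [X] sum to at most 7r/11 + r, so at least (2r/11)
   #|X| >= 3r^2/11 > 2rm arcs leave [X]. *)
have : 11 * (2 * arcs e X X) <= #|X| * (18 * r).
  rewrite [2 * _]mul2n -addnn {1}arcs_out arcs_in -big_split -sum_nat_const.
  rewrite big_distrr /=.
  apply: leq_sum => w _; have := none w.
  have : #|[set y in X | e w y]| <= r.
    rewrite -(e_regular w).1; apply/subset_leq_card/subsetP => u.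
    by rewrite !inE => /andP[].
  have : #|[set y in X | e y w]| <= r.
    rewrite -(e_regular w).2; apply/subset_leq_card/subsetP => u.
    by rewrite !inE => /andP[].
  lia.
have := arcs_out_setC e_regular X X.
nia.
Qed.

Lemma regular_digraph_cut_false : 0 < #|T| -> False.
Proof.
move=> /card_gt0P[v _].
pose good X := (boundary X <= 2 * r * m) && (r <= 2 * #|X|).
have goodT : good setT.
  rewrite /good arcs_in setCT big_set0 /=.
  have : out_degree e v <= #|[set: T]| by rewrite subset_leq_card ?subsetT.
  rewrite (e_regular v).1; lia.
case: (arg_minnP (fun X : {set T} => #|X|) goodT) => X /andP[dX le_X] minX.
have {le_X} le_X := small_boundary_card dX le_X.
have [w [w_out w_in]] := exists_balanced_vertex dX le_X.
have [Z [S [cS wZS Zw ZS]]] := cut w.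
have dZ : boundary Z <= r * m.
  apply: leq_trans (arcs_closed_cut e_regular ZS) _.
  by rewrite leq_mul2l cS orbT.
have := arcs_split e X Z; rewrite (arcs_setC_sym e_regular Z) => dsplit.
(* Out-neighbours of [w] lie in [Z] or [S], and 7/11 - 3/22 = 1/2. *)
have cI : r < 2 * #|X :&: Z|.
  suff : #|[set u in X | e w u]| <= #|X :&: Z| + #|S| by lia.
  rewrite (leq_trans _ (leq_card_setU _ _)) //.
  apply/subset_leq_card/subsetP => u.
  by rewrite !inE => /andP[-> /wZS]; rewrite inE.
have cD : r < 2 * #|X :\: Z|.
  suff : #|[set u in X | e u w]| <= #|X :\: Z| by lia.
  apply/subset_leq_card/subsetP => u.
  by rewrite !inE => /andP[-> uw]; rewrite andbT; apply: contraL uw; apply: Zw.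
have : ~~ good (X :&: Z).
  by apply/negP => /minX; have := cardsID Z X; lia.
have : ~~ good (X :\: Z).
  by apply/negP => /minX; have := cardsID Z X; lia.
rewrite /good (ltnW cI) (ltnW cD) !andbT -!ltnNge; lia.
Qed.

End Main.

Local Open Scope ring_scope.

Theorem theorem1p8 (r : nat) (T : finType) (e : rel T)
  (T_nonempty : (0 < #|T|)%N) (e_loopless : irreflexive e)
  (e_regular : regular_digraph r e) :
  Num.ceil (3 / 22 * r%:R : rat) <= (max_openly_disjoint e)%:Z.
Proof.
set m := max_openly_disjoint e.
have le_m : (3 * r <= 22 * m)%N.
  rewrite leqNgt; apply/negP => lt_m.
  exact: (regular_digraph_cut_false e_regular lt_m
            (openly_disjoint_cut e_loopless)).
rewrite Num.Theory.real_ceil_le_int ?Num.Theory.num_real // -pmulrn.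
by move: le_m; rewrite -(Num.Theory.ler_nat rat) !GRing.natrM; lra.
Qed.
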